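(* Let $\widetilde{\mathcal L}$ be the twisted $N=2$ superconformal algebra over $\mathbb C$. Then its automorphism group is a semidirect product of the normal subgroup of inner automorphisms by a cyclic group of order $4$: $\mathrm{Aut}(\widetilde{\mathcal L})=\mathrm{Inn}(\widetilde{\mathcal L})\rtimes\mathbb Z_4$.
   Context: The twisted $N=2$ superconformal algebra $\widetilde{\mathcal L}$ is the Lie superalgebra over $\mathbb C$ with basis $\{L_n,\,T_r,\,G_p,\,\mathfrak c \mid n\in\mathbb Z,\ r\in\frac12+\mathbb Z,\ p\in\frac12\mathbb Z\}$, where the $L_n,T_r,\mathfrak c$ span the even part $\widetilde{\mathcal L}_{\bar 0}$ and the $G_p$ span the odd part $\widetilde{\mathcal L}_{\bar 1}$. The non-vanishing super brackets of basis elements are (up to super skew-symmetry; $\mathfrak c$ is central) $[L_m,L_n]=(m-n)L_{m+n}+\frac{m^3-m}{12}\delta_{m+n,0}\mathfrak c$; $[L_m,T_r]=-rT_{r+m}$; $[T_r,T_s]=\frac r3\delta_{r+s,0}\mathfrak c$; $[L_m,G_p]=(\frac m2-p)G_{p+m}$; $[T_r,G_p]=G_{p+r}$; $[G_p,G_q]=(-1)^{2p}\big(2L_{p+q}+\frac13(p^2-\frac14)\delta_{p+q,0}\mathfrak c\big)$ if $p+q\in\mathbb Z$; $[G_p,G_q]=(-1)^{2p+1}(p-q)T_{p+q}$ if $p+q\in\frac12+\mathbb Z$. $\mathrm{Aut}(\widetilde{\mathcal L})$ is the group of bijective linear maps $\sigma:\widetilde{\mathcal L}\to\widetilde{\mathcal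 L}$ with $\sigma(\widetilde{\mathcal L}_{\bar0})=\widetilde{\mathcal L}_{\bar0}$, $\sigma(\widetilde{\mathcal L}_{\bar1})=\widetilde{\mathcal L}_{\bar1}$ and $\sigma([x,y])=[\sigma(x),\sigma(y)]$ for all $x,y$. $\mathrm{Inn}(\widetilde{\mathcal L})$, the inner automorphism group, is the group generated by the automorphisms $\exp(l_0\,\mathrm{ad}\,L_0)$, $l_0\in\mathbb C^*=\mathbb C\setminus\{0\}$, where $\exp(l_0\,\mathrm{ad}\,L_0)$ multiplies each $x$ satisfying $[L_0,x]=-p\,x$ by $e^{-l_0p}$. $\mathbb Z_4=\mathbb Z/4\mathbb Z$. *)

(* Defs.v *)
From HB Require Import structures.
From mathcomp Require Import all_boot all_order all_algebra.
From mathcomp Require Import boolp classical_sets reals sequences exp trigo.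
From mathcomp Require Import finmap complex monalg.

Set Implicit Arguments.
Unset Strict Implicit.
Unset Printing Implicit Defensive.

Import GRing.Theory Num.Theory.

Local Open Scope classical_set_scope.
Local Open Scope ring_scope.
Local Open Scope complex_scope.

Section InfiniteGroups.
Context {G : groupType}.
Implicit Types N H : set G.
Local Open Scope group_scope.

Definition subgroup H : Prop := group_closed [in H].

Definition normal_subgroup N : Prop :=
  subgroup N /\ forall n g, N n -> N (n ^ g).

Definition generated_subgroup (A : set G) : set G := smallest subgroup A.

Definition internal_semidirect N H : Prop :=
  [/\ normal_subgroup N, subgroup H, N `&` H = [set 1] &
      forall g, exists2 n, N n & exists2 h, H h & g = n * h].

(* H is the isomorphic image of the additive group Z/4Z. *)
Definition isomorphic_Z4 H : Prop :=
  exists phi : 'Z_4 -> G,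
    [/\ {morph phi : i j / (i + j)%R >-> i * j}, injective phi &
        range phi = H].

End InfiniteGroups.

(* e^(x + iy) = e^x (cos y + i sin y) *)
Definition expC {R : realType} (z : R[i]) : R[i] :=
  let: x +i* y := z in (expR x * cos y) +i* (expR x * sin y).

(* The half-integers are encoded by integers:
   iL n is the index of L_n, iT k that of T_(k + 1/2), iG k that of G_(k/2). *)
Inductive tw_index := iL of int | iT of int | iG of int | ic.

Definition tw_index_code (b : tw_index) : int + int + int + unit :=
  match b with
  | iL n => inl (inl (inl n))
  | iT k => inl (inl (inr k))
  | iG k => inl (inr k)
  | ic => inr tt
  end.

Definition tw_index_decode (s : int + int + int + unit) : tw_index :=
  match s with
  | inl (inl (inl n)) => iL n
  | inl (inl (inr k)) => iT k
  | inl (inr k) => iG k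
  | inr _ => ic
  end.

Lemma tw_index_codeK : cancel tw_index_code tw_index_decode.
Proof. by case. Qed.

HB.instance Definition _ := Choice.copy tw_index (can_type tw_index_codeK).

Definition tw_odd (b : tw_index) : bool := if b is iG _ then true else false.

Section TwistedN2.
Context {R : realType}.
Local Notation C := (R[i]).

Definition twN2 : Type := {malg C[tw_index]}.

Definition Lgen (n : int) : twN2 := << iL n >>.
Definition Tgen (k : int) : twN2 := << iT k >>.
Definition Ggen (k : int) : twN2 := << iG k >>.
Definition cgen : twN2 := << ic >>.

Definition Tdeg (k : int) : C := k%:~R + 2^-1.
Definition Gdeg (k : int) : C := k%:~R / 2.

Definition delta0 (n : int) : C := (n == 0)%:R.

(* Values on the pairs (T, L), (G, L) and (G, T) come from super
   skew-symmetry. For G_p, G_q with p = k/2 and q = l/2 one has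
   p + q = (k + l)/2, and (-1)^(2p) = (-1)^k; %/ is Euclidean, so
   T_(p+q) has code (k + l) %/ 2 when k + l is odd. *)
Definition tw_br_basis (a b : tw_index) : twN2 :=
  match a, b with
  | iL m, iL n =>
      (m - n)%:~R *: Lgen (m + n) +
      ((m ^+ 3 - m)%:~R / 12 * delta0 (m + n)) *: cgen
  | iL m, iT k => - Tdeg k *: Tgen (k + m)
  | iT k, iL m => Tdeg k *: Tgen (k + m)
  | iT k, iT l => (Tdeg k / 3 * delta0 (k + l + 1)) *: cgen
  | iL m, iG k => (m%:~R / 2 - Gdeg k) *: Ggen (k + 2 * m)
  | iG k, iL m => - (m%:~R / 2 - Gdeg k) *: Ggen (k + 2 * m)
  | iT k, iG l => Ggen (l + 2 * k + 1)
  | iG l, iT k => - Ggen (l + 2 * k + 1)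
  | iG k, iG l =>
      if (2 %| k + l)%Z then
        (-1) ^ k *: (2 *: Lgen ((k + l) %/ 2)%Z +
          (3^-1 * (Gdeg k ^+ 2 - 4^-1) * delta0 (k + l)) *: cgen)
      else ((-1) ^ (k + 1) * (Gdeg k - Gdeg l)) *: Tgen ((k + l) %/ 2)%Z
  | ic, _ | _, ic => 0
  end.

Definition tw_br (x y : twN2) : twN2 :=
  \sum_(a <- msupp x) \sum_(b <- msupp y) (x@_a * y@_b) *: tw_br_basis a b.

(* part false is the even part, part true the odd part. *)
Definition tw_part (e : bool) : set twN2 :=
  [set x | forall b, b \in msupp x -> tw_odd b = e].

Definition is_aut (s : twN2 -> twN2) : Prop :=
  [/\ linear s, bijective s,
      forall e, s @` tw_part e = tw_part e &
      {morph s : x y / tw_br x y}].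

Record aut := Aut { aut_fun :> twN2 -> twN2; autP : is_aut aut_fun }.

Lemma aut_inj (s t : aut) : s =1 t -> s = t.
Proof.
case: s t => [s Ps] [t Pt] /= /funext est; move: Ps Pt; rewrite est => Ps Pt.
by congr Aut; apply: Prop_irrelevance.
Qed.

HB.instance Definition _ := gen_eqMixin aut.
HB.instance Definition _ := gen_choiceMixin aut.

Lemma is_aut_id : is_aut id.
Proof. by split=> // [|e]; [exists id | rewrite image_id]. Qed.

Lemma is_aut_comp (s t : aut) : is_aut (s \o t).
Proof.
case: s t => [s [sl sb sp sm]] [t [tl tb tp tm]] /=; split.
- by move=> a x y /=; rewrite tl sl.
- exact: bij_comp.
- by move=> e; rewrite -classical_sets.image_comp tp sp.
- by move=> x y /=; rewrite tm sm.
Qed.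

Lemma aut_inv_subproof (s : aut) :
  exists t : aut, cancel s t /\ cancel t s.
Proof.
case: s => [s [sl [t st ts] sp sm]].
suff tP : is_aut t by exists (Aut tP).
split.
- by move=> a x y; rewrite -{1}[x]ts -{1}[y]ts -sl st.
- by exists s.
- move=> e; rewrite -{1}(sp e) classical_sets.image_comp.
  by rewrite (_ : t \o s = id) ?image_id //; apply/funext.
- by move=> x y; rewrite -{1}[x]ts -{1}[y]ts -sm st.
Qed.

Definition aut_one : aut := Aut is_aut_id.
Definition aut_mul (s t : aut) : aut := Aut (is_aut_comp s t).
Definition aut_inv (s : aut) : aut := sval (cid (aut_inv_subproof s)).

Lemma aut_mulA : associative aut_mul.
Proof. by move=> s t u; apply: aut_inj. Qed.

Lemma aut_mul1 : left_id aut_one aut_mul.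
Proof. by move=> s; apply: aut_inj. Qed.

Lemma aut_mulr1 : right_id aut_one aut_mul.
Proof. by move=> s; apply: aut_inj. Qed.

Lemma aut_mulV : left_inverse aut_one aut_inv aut_mul.
Proof.
by move=> s; apply: aut_inj => x; rewrite /= /aut_inv; case: cid => t [].
Qed.

Lemma aut_mulVr : right_inverse aut_one aut_inv aut_mul.
Proof.
by move=> s; apply: aut_inj => x; rewrite /= /aut_inv; case: cid => t [].
Qed.

HB.instance Definition _ :=
  isGroup.Build aut aut_mulA aut_mul1 aut_mulr1 aut_mulV aut_mulVr.

(* The eigenvectors of ad L_0 span the algebra, so this determines s. *)
Definition is_exp_adL0 (l : C) (s : aut) : Prop :=
  forall (p : C) (x : twN2),
    tw_br (Lgen 0) x = - p *: x -> s x = expC (- (l * p)) *: x.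

Definition Inn : set aut :=
  generated_subgroup [set s | exists2 l : C, l != 0 & is_exp_adL0 l s].

End TwistedN2.

Arguments twN2 : clear implicits.
Arguments aut : clear implicits.
Arguments Inn : clear implicits.

(* Main.v *)
From HB Require Import structures.
Require Import Defs.
From mathcomp Require Import all_boot all_algebra.
From mathcomp Require Import classical_sets reals.
From mathcomp Require Import all_order boolp sequences exp trigo.
From mathcomp Require Import finmap complex monalg ring zify.

(** Give the algebra the integer grading in which [L_n], [T_(k + 1/2)],
[G_(k/2)] and [c] have degrees [2n], [2k + 1], [k] and [0]; it is twice the
opposite of the [ad L_0]-weight.  The elements [G_(k/2)] generate the algebra, so
that an automorphism is known once its values on them are
([automorphism_ext]).  Two kinds of automorphisms are visible: multiplication
by [z ^ degree] for a nonzero scalar [z], and the reflection [rho], which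
reverses the degree, sends [L_n] to [- L_(-n)] and [G_(k/2)] to
[i G_(-k/2)], and has order 4.

These are all.  Let [s] be an automorphism.  Every [s G_(k/2)] is an eigenvector
of [ad (s L_0)].  Were there a component of positive degree in [s L_0], take the
one of largest degree [d] and let [q] be the largest degree in [s G_(k/2)].  The
component of degree [d + q] of the bracket is the bracket of the two leading
terms ([br_leading]) and has to vanish; this forces [q = d / 2].  So the degrees
in the image of the odd part are bounded above, which contradicts surjectivity
([automorphism_L0_top]).  The same argument for [rho s] excludes negative
degrees.  Hence [s L_0] is a combination of [L_0] and [c], and comparing
eigenvalues shows that [s] maps the line of [G_(k/2)] to that of [G_(q k/2)] for
a fixed sign [q] ([automorphism_on_G]).

If [q = 1], write [g k] for the eigenvalue of [s] on [G_(k/2)].  Since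
[[G_0, G_(1/2)] = T_(1/2) / 2] and [[T_(1/2), G_(k/2)] = G_((k + 1)/2)], the
scalars satisfy [g (k + 1) = g 0 * g 1 * g k].  So [g 0] is a sign and [g k] is
[g 0 * z ^ k] with [z = g 0 * g 1] ([automorphism_scale]): up to the parity
automorphism [rho ^ 2], [s] is multiplication by [z ^ degree].  If [q = -1], the
same applies to [s rho].

As the exponential maps onto the nonzero complex numbers, the automorphisms
[z ^ degree] are the inner ones ([InnE]).  They form a normal subgroup, since
an automorphism keeps the degree or reverses it, and they fix [G_0], on which
[rho ^ n] acts by [i ^ n]; so they meet the cyclic group generated by [rho]
trivially. *)

Set Implicit Arguments.
Unset Strict Implicit.
Unset Printing Implicit Defensive.

Import Order.TTheory GRing.Theory Num.Theory.

Local Open Scope classical_set_scope.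
Local Open Scope ring_scope.

(** * Linear maps given on a basis *)

Section LinearExtension.
Context {F : comNzRingType} {K : choiceType} {V : lmodType F}.
Implicit Types (f : K -> V) (x : {malg F[K]}).

Definition linear_extend f x : V := \sum_(b <- msupp x) x@_b *: f b.

Lemma linear_extendEw f x (d : {fset K}) : (msupp x `<=` d)%fset ->
  linear_extend f x = \sum_(b <- d) x@_b *: f b.
Proof.
move=> sd; rewrite /linear_extend (big_fset_incl _ sd) //= => b _ bx.
by rewrite mcoeff_outdom // scale0r.
Qed.

Lemma linear_extend_linear f : linear (linear_extend f).
Proof.
move=> a x y; pose d := (msupp x `|` msupp y)%fset.
rewrite (linear_extendEw f (fsubsetUl _ _ : msupp x `<=` d)%fset).
rewrite (linear_extendEw f (fsubsetUr _ _ : msupp y `<=` d)%fset).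
rewrite (@linear_extendEw _ _ d).
  rewrite scaler_sumr -big_split /=; apply: eq_bigr => b _.
  by rewrite mcoeffD mcoeffZ scalerDl scalerA.
apply: fsubset_trans (msuppD_le _ _) _.
by apply: fsetSU; apply: msuppZ_le.
Qed.

HB.instance Definition _ f :=
  GRing.isLinear.Build F {malg F[K]} V *:%R
    (linear_extend f) (linear_extend_linear f).

Lemma linear_extendU f b : linear_extend f << b >> = f b.
Proof.
by rewrite /linear_extend msuppU oner_eq0 big_seq_fset1 mcoeffUU scale1r.
Qed.

Lemma linear_extendE (s : {malg F[K]} -> V) :
  linear s -> s =1 linear_extend (fun b => s << b >>).
Proof.
move=> sl x; pose s' : {linear {malg F[K]} -> V} :=
  HB.pack s (GRing.isLinear.Build F {malg F[K]} V *:%R s sl).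
rewrite -[s]/(s' : _ -> _) {1}[x]monalgE raddf_sum; apply: eq_bigr => b _.
rewrite -linearZ /=; congr s; apply/malgP => k.
by rewrite mcoeffZ !mcoeffU mulr_natr.
Qed.

Lemma linear_add (s : {malg F[K]} -> V) x y :
  linear s -> s (x + y) = s x + s y.
Proof. by move/(_ 1 x y); rewrite !scale1r. Qed.

Lemma linear_scale (s : {malg F[K]} -> V) a x :
  linear s -> s (a *: x) = a *: s x.
Proof. by move=> sl; exact: (scalable_linear sl). Qed.

Lemma linear_ext (s t : {malg F[K]} -> V) : linear s -> linear t ->
  (forall b, s << b >> = t << b >>) -> s =1 t.
Proof.
move=> sl tl st x; rewrite (linear_extendE sl) (linear_extendE tl).
by apply: eq_bigr => b _; rewrite st.
Qed.

End LinearExtension.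

Section Monomial.
Context {F : comNzRingType} {K : choiceType}.
Implicit Types (d : K -> F) (r : K -> K) (x : {malg F[K]}).

Definition monomial_map d r : {malg F[K]} -> {malg F[K]} :=
  linear_extend (fun b => d b *: << r b >>).

Lemma monomial_mapE d r x b :
  injective r -> (monomial_map d r x)@_(r b) = d b * x@_b.
Proof.
move=> rI; rewrite /monomial_map /linear_extend raddf_sum /=.
under eq_bigr do rewrite !mcoeffZ mcoeffU (inj_eq rI).
have [bx|bx] := boolP (b \in msupp x); last first.
  rewrite (mcoeff_outdom bx) mulr0 big1_seq // => a /andP[_ ax].
  by case: eqP ax bx => [-> -> //|_ _ _]; rewrite !mulr0.
rewrite (big_fsetD1 b) //= eqxx mulr1 big1_seq ?addr0 1?mulrC // => a /=.
by rewrite !inE => /andP[/negPf -> _]; rewrite !mulr0.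
Qed.

End Monomial.

(** * The algebra over an abstract field *)

Section Bracket.
Context {F : numClosedFieldType}.
Local Notation V := {malg F[tw_index]}.
Implicit Types (x y : V) (s : V -> V).

Definition degT (k : int) : F := k%:~R + 2^-1.
Definition degG (k : int) : F := k%:~R / 2.

(** The bracket of the complex algebra, written over any field of this class:
the arguments about automorphisms need only characteristic 0 and a square root
of -1.  The two brackets agree for the field of complex numbers, which is what
[is_autE] records. *)
Definition br_basis (a b : tw_index) : V :=
  match a, b with
  | iL m, iL n =>
      (m - n)%:~R *: << iL (m + n) >> +
      ((m ^+ 3 - m)%:~R / 12 * (m + n == 0)%:R) *: << ic >>
  | iL m, iT k => - degT k *: << iT (k + m) >>
  | iT k, iL m => degT k *: << iT (k + m) >>
  | iT k, iT l => (degT k / 3 * (k + l + 1 == 0)%:R) *: << ic >>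
  | iL m, iG k => (m%:~R / 2 - degG k) *: << iG (k + 2 * m) >>
  | iG k, iL m => - (m%:~R / 2 - degG k) *: << iG (k + 2 * m) >>
  | iT k, iG l => << iG (l + 2 * k + 1) >>
  | iG l, iT k => - << iG (l + 2 * k + 1) >>
  | iG k, iG l =>
      if (2 %| k + l)%Z then
        (-1) ^ k *: (2 *: << iL ((k + l) %/ 2)%Z >> +
          (3^-1 * (degG k ^+ 2 - 4^-1) * (k + l == 0)%:R) *: << ic >>)
      else ((-1) ^ (k + 1) * (degG k - degG l)) *: << iT ((k + l) %/ 2)%Z >>
  | ic, _ | _, ic => 0
  end.

Definition br x y : V :=
  \sum_(a <- msupp x) \sum_(b <- msupp y) (x@_a * y@_b) *: br_basis a b.

Definition parity_part (e : bool) : set V :=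
  [set x | forall b, b \in msupp x -> tw_odd b = e].

Definition is_automorphism s : Prop :=
  [/\ linear s, bijective s, forall e, s @` parity_part e = parity_part e &
      {morph s : x y / br x y}].

End Bracket.

Lemma tw_br_basisE (R : realType) a b :
  tw_br_basis a b = br_basis a b :> {malg R[i][tw_index]}.
Proof. by case: a b => [m|k|k|] [n|l|l|]. Qed.

Lemma is_autE (R : realType) (s : twN2 R -> twN2 R) :
  is_aut s = is_automorphism (s : {malg R[i][tw_index]} -> {malg R[i][tw_index]}).
Proof.
rewrite /is_aut /is_automorphism.
have brE : forall x y, tw_br x y = br x y :> {malg R[i][tw_index]}.
move=> x y; apply: eq_bigr => a _; apply: eq_bigr => b _.
by rewrite tw_br_basisE.
have -> : {morph s : x y / tw_br x y} = {morph s : x y / br x y}.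
  by apply/propext; split=> h x y; have := h x y; rewrite !brE.
by [].
Qed.

(** * Grading and reflection automorphisms *)

Definition tw_deg (b : tw_index) : int :=
  match b with
  | iL n => 2 * n
  | iT k => 2 * k + 1
  | iG k => k
  | ic => 0
  end.

(** On the true indices this is [p |-> - p]; the shift comes from encoding
[T_(k + 1/2)] by [k]. *)
Definition reflect_index (b : tw_index) : tw_index :=
  match b with
  | iL n => iL (- n)
  | iT k => iT (- 1 - k)
  | iG k => iG (- k)
  | ic => ic
  end.

Lemma reflect_indexK : involutive reflect_index.
Proof. by case=> [n|k|k|] //=; congr (_ _); lia. Qed.

Section Automorphisms.
Context {F : numClosedFieldType}.
Local Notation V := {malg F[tw_index]}.
Implicit Types (x y : V) (s : V -> V).

Lemma brE x y : br x y = linear_extend (fun a => linear_extend (br_basis a) y) x.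
Proof.
apply: eq_bigr => a _; rewrite scaler_sumr.
by apply: eq_bigr => b _; rewrite scalerA.
Qed.

Lemma brEr x y : br x y = linear_extend (fun b => linear_extend (br_basis^~ b) x) y.
Proof.
rewrite /br exchange_big; apply: eq_bigr => b _; rewrite scaler_sumr.
by apply: eq_bigr => a _; rewrite scalerA mulrC.
Qed.

Lemma br_linearl y : linear (br^~ y).
Proof. by move=> a x x'; rewrite !brE linearP. Qed.

Lemma br_linearr x : linear (br x).
Proof. by move=> a y y'; rewrite !brEr linearP. Qed.

Lemma brZl c x y : br (c *: x) y = c *: br x y.
Proof. exact: (scalable_linear (br_linearl y)). Qed.

Lemma brZr c x y : br x (c *: y) = c *: br x y.
Proof. exact: (scalable_linear (br_linearr x)). Qed.

Lemma brUU a b : br << a >> << b >> = br_basis a b :> V.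
Proof. by rewrite brE !linear_extendU. Qed.

(** The bracket being bilinear, compatibility is a matter of basis vectors. *)
Lemma br_morph s : linear s ->
    (forall a b, s (br_basis a b) = br (s << a >>) (s << b >>)) ->
  {morph s : x y / br x y}.
Proof.
move=> sl sb x y.
have brl z := br_linearl z; have brr z := br_linearr z.
move: x; apply: linear_ext => [a x x'|a x x'|a]; first by rewrite brl sl.
  by rewrite sl brl.
move: y; apply: linear_ext => [c y y'|c y y'|b]; first by rewrite brr sl.
  by rewrite sl brr.
by rewrite brUU sb.
Qed.

(** A map that permutes the basis lines by an involution is inverted by a map of
the same kind, so only the bracket relations between basis vectors are left to
check. *)
Lemma monomial_automorphism (d : tw_index -> F) (r : tw_index -> tw_index) :
    involutive r -> (forall b, d b != 0) ->
    (forall b, tw_odd (r b) = tw_odd b) ->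
    (forall a b, monomial_map d r (br_basis a b) =
                 (d a * d b) *: br_basis (r a) (r b)) ->
  is_automorphism (monomial_map d r).
Proof.
move=> rK d0 ro rbr; have rI := inv_inj rK.
pose d' b := (d (r b))^-1.
have coef e x b : (monomial_map e r x)@_b = e (r b) * x@_(r b).
  by rewrite -[in LHS](rK b) monomial_mapE.
have st : cancel (monomial_map d r) (monomial_map d' r).
  by move=> x; apply/malgP => b; rewrite !coef /d' !rK mulrA mulVf ?mul1r.
have ts : cancel (monomial_map d' r) (monomial_map d r).
  by move=> x; apply/malgP => b; rewrite !coef /d' !rK mulrA mulfV ?mul1r.
have part_mono e h x : parity_part h x -> parity_part h (monomial_map e r x).
  move=> xh b; rewrite -mcoeff_neq0 coef mulf_eq0 negb_or mcoeff_neq0.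
  by case/andP=> _ /xh <-; rewrite ro.
split.
- exact: linear_extend_linear.
- exact: Bijective st ts.
- move=> h; apply/seteqP; split=> [_ [x xh <-]|x xh]; first exact: part_mono.
  by exists (monomial_map d' r x); [exact: part_mono | exact: ts].
- apply: br_morph => [|a b]; first exact: linear_extend_linear.
  by rewrite rbr /monomial_map !linear_extendU brZl brZr brUU scalerA.
Qed.

(** The bracket is graded: this yields the grading automorphisms at once, and
isolates leading terms later. *)
Lemma br_basis_homogeneous a b c :
  (br_basis a b : V)@_c != 0 -> tw_deg c = tw_deg a + tw_deg b.
Proof.
have U d (e : F) : (e *: << d >> : V)@_c != 0 -> c = d /\ e != 0.
  rewrite mcoeffZ mcoeffU mulf_eq0 negb_or => /andP[-> ].
  by case: (d =P c) => [-> //|_]; rewrite eqxx.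
have D x y : (x + y)@_c != 0 -> x@_c != 0 \/ y@_c != 0.
  rewrite mcoeffD; case: (eqVneq x@_c 0) => [->|]; last by left.
  by rewrite add0r; right.
have delta e (n : int) : e * (n == 0)%:R != 0 :> F -> n = 0.
  by case: (n =P 0) => // _; rewrite mulr0 eqxx.
case: a b => [m|k|k|] [n|l|l|] /=; rewrite ?mcoeff0 ?eqxx //.
- case/D => /U [-> //=]; first by lia.
  by move/delta; lia.
- by case/U=> -> _ /=; lia.
- by case/U=> -> _ /=; lia.
- by case/U=> -> _ /=; lia.
- by case/U=> -> /delta /=; lia.
- by rewrite -[<<_>>]scale1r => /U[-> _] /=; lia.
- by case/U=> -> _ /=; lia.
- by rewrite -scaleN1r => /U[-> _] /=; lia.
- case: ifP => ev; last by case/U=> -> _ /=; lia.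
  rewrite mcoeffZ mulf_eq0 negb_or => /andP[_] /D [] /U [-> //=]; first by lia.
  by move/delta; lia.
Qed.

Lemma grading_automorphism (t : F) : t != 0 ->
  is_automorphism (monomial_map (fun b => t ^ tw_deg b) id).
Proof.
move=> t0.
apply: (@monomial_automorphism (fun b => t ^ tw_deg b) id) => [//|b|//|a b].
  exact: expfz_neq0.
apply/malgP => c; rewrite [LHS]monomial_mapE // mcoeffZ.
have [->|nz] := eqVneq (br_basis a b : V)@_c 0; first by rewrite !mulr0.
by rewrite (br_basis_homogeneous nz) expfzDr.
Qed.

(** [L_n] has to change sign because the structure constant [m - n] of
[[L_m, L_n]] does when the degrees are reversed; then [[G_p, G_p] = 2 L_(2p)],
for a nonzero integer [p], forces a square root of -1 on the odd part, which is
why the order is 4 and not 2. *)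
Definition reflect_coef (b : tw_index) : F :=
  match b with
  | iL _ | ic => -1
  | iT _ => 1
  | iG _ => 'i
  end.

Definition reflection : V -> V := monomial_map reflect_coef reflect_index.

Lemma reflection_automorphism : is_automorphism reflection.
Proof.
have mmU b : reflection << b >> = reflect_coef b *: << reflect_index b >>.
  by rewrite /reflection /monomial_map linear_extendU.
have mmZ c x : reflection (c *: x) = c *: reflection x.
  exact: (scalable_linear (linear_extend_linear _)).
have mmD x y : reflection (x + y) = reflection x + reflection y.
  by rewrite /reflection /monomial_map linearD.
have mmN x : reflection (- x) = - reflection x.
  by rewrite /reflection /monomial_map linearN.
have mm0 : reflection 0 = 0 by rewrite /reflection /monomial_map linear0.
apply: monomial_automorphism => [||b|a b]; first exact: reflect_indexK.
- by case=> [n|k|k|] //=; rewrite ?oppr_eq0 ?oner_eq0 ?neq0Ci.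
- by case: b.
rewrite -/reflection.
have opp0 (m n : int) : m = - n -> (m == 0) = (n == 0).
  by move=> ->; rewrite oppr_eq0.
have eqZU (c c' : F) (u u' : tw_index) : c = c' -> u = u' ->
    c *: << u >> = c' *: << u' >> :> V by move=> -> ->.
have eqD x x' y y' : x = x' -> y = y' -> x + y = x' + y' by move=> -> ->.
have scaleD c x y : c *: (x + y) = c *: x + c *: y by rewrite scalerDr.
have scaleD2 c d e x y : c *: (d *: x + e *: y) = (c * d) *: x + (c * e) *: y.
  by rewrite scalerDr !scalerA.
have scaleA c d x : c *: (d *: x) = (c * d) *: x by rewrite scalerA.
have ii : 'i * 'i = -1 :> F by rewrite -expr2 sqrCi.
case: a b => [m|k|k|] [n|l|l|]; rewrite /br_basis /=.
- rewrite mmD 2!mmZ 2!mmU /= scaleD !scaleA (opp0 (- m - n) (m + n)); last lia.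
  move: (_ == _)%:R => delta.
  apply: eqD; apply: eqZU; [by ring | by congr iL; lia | by ring | by []].
- rewrite mmZ mmU /= !scaleA /degT.
  apply: eqZU; [by field; rewrite ?pnatr_eq0 | by congr iT; lia].
- rewrite mmZ mmU /= !scaleA /degG.
  apply: eqZU; [by ring | by congr iG; lia].
- by rewrite mm0 scaler0.
- rewrite mmZ mmU /= !scaleA /degT.
  apply: eqZU; [by field; rewrite ?pnatr_eq0 | by congr iT; lia].
- rewrite mmZ mmU /= !scaleA /degT.
  rewrite (opp0 (-1 - k + (-1 - l) + 1) (k + l + 1)); last lia.
  by move: (_ == _)%:R => delta; apply: eqZU => //; field; rewrite ?pnatr_eq0.
- by rewrite mmU /= mul1r; apply: eqZU => //; congr iG; lia.
- by rewrite mm0 scaler0.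
- rewrite mmZ mmU /= !scaleA /degG.
  apply: eqZU; [by ring | by congr iG; lia].
- rewrite mmN mmU /= mulr1 (_ : - (k + 2 * l + 1) = - k + 2 * (-1 - l) + 1).
    by rewrite scalerN.
  by lia.
- have -> : (2 %| - k - l)%Z = (2 %| k + l)%Z by lia.
  have sgnN (n : int) : (-1) ^ (- n) = (-1) ^ n :> F.
    by rewrite -exprz_inv invrN1.
  have sgnN1 : (-1) ^ (- k + 1) = (-1) ^ (k + 1) :> F.
    rewrite -[RHS]sgnN opprD (_ : - k + 1 = - k - 1 + 2); last lia.
    rewrite [LHS]expfzDr ?oppr_eq0 ?oner_eq0 //.
    by rewrite -[X in _ * X]exprnP sqrrN expr1n mulr1.
  rewrite ii; have [ev|ev] := boolP (2 %| k + l)%Z.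
    rewrite mmZ mmD 2!mmZ 2!mmU /= 3!scaleD2 2!scaleA.
    rewrite (opp0 (- k - l) (k + l)); last lia.
    rewrite sgnN /degG; move: (_ == _)%:R => delta.
    apply: eqD; apply: eqZU; [by ring | by congr iL; lia | by ring | by []].
  rewrite mmZ mmU /= sgnN1 2!scaleA /degG.
  apply: eqZU; [by ring | by congr iT; lia].
all: by rewrite mm0 scaler0.
Qed.
End Automorphisms.

(** * Generation by the odd part and leading terms *)

Section Classification.
Context {F : numClosedFieldType}.
Local Notation V := {malg F[tw_index]}.
Implicit Types (x y : V) (s t : V -> V).

Lemma br_basis_GG_even k l n : k + l = 2 * n ->
  br_basis (iG k) (iG l) = (-1) ^ k *: (2 *: << iL n >> +
    (3^-1 * (degG k ^+ 2 - 4^-1) * (n == 0)%:R) *: << ic >>) :> V.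
Proof.
move=> kl; rewrite /br_basis (_ : (2 %| k + l)%Z = true); last lia.
rewrite (_ : (k + l == 0) = (n == 0)); last lia.
by rewrite (_ : ((k + l) %/ 2)%Z = n) //; lia.
Qed.

Lemma br_basis_GG_odd k l n : k + l = 2 * n + 1 ->
  br_basis (iG k) (iG l) =
    ((-1) ^ (k + 1) * (degG k - degG l)) *: << iT n >> :> V.
Proof.
move=> kl; rewrite /br_basis (_ : (2 %| k + l)%Z = false); last lia.
by rewrite (_ : ((k + l) %/ 2)%Z = n) //; lia.
Qed.

Lemma br_basis_G0G1 : br_basis (iG 0) (iG 1) = 2^-1 *: << iT 0 >> :> V.
Proof.
rewrite (@br_basis_GG_odd _ _ 0) // /degG; congr (_ *: _).
by rewrite add0r expr1z; field; rewrite ?pnatr_eq0.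
Qed.

(** Brackets of odd elements span the even part: [L_0] comes from
[[G_(1/2), G_(-1/2)]], where the central term vanishes, then [c] from
[[G_0, G_0]], then [L_n] from
[[G_(n/2), G_(n/2)]] and [T_r] from [[G_0, G_r]]. *)
Lemma automorphism_ext s t : is_automorphism s -> is_automorphism t ->
  (forall k, s << iG k >> = t << iG k >>) -> s =1 t.
Proof.
case=> [sl _ _ sm] [tl _ _ tm] stG.
pose e x := s x = t x.
have eD x y : e x -> e y -> e (x + y) by rewrite /e !linear_add // => -> ->.
have eZ c x : e x -> e (c *: x) by rewrite /e !linear_scale // => ->.
have eZV c x : c != 0 -> e (c *: x) -> e x.
  by move=> c0 /(eZ c^-1); rewrite scalerA mulVf ?scale1r.
have eB x y : e (x + y) -> e y -> e x.
  move=> exy /(eZ (-1)); rewrite scaleN1r => /(eD _ _ exy).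
  by rewrite addrK.
have eG k l : e (br_basis (iG k) (iG l)) by rewrite /e -brUU sm tm !stG.
have sgn0 (n : int) : (-1) ^ n != 0 :> F by rewrite expfz_neq0 ?oppr_eq0 ?oner_eq0.
have two0 : 2 != 0 :> F by rewrite pnatr_eq0.
have eL0 : e << iL 0 >>.
  have := eG 1 (-1); rewrite (@br_basis_GG_even _ _ 0) // => /eZV - /(_ (sgn0 _)).
  rewrite (_ : 3^-1 * _ * _ = 0); last first.
    by rewrite /degG; field; rewrite ?pnatr_eq0.
  by rewrite scale0r addr0 => /eZV; apply.
have ec : e << ic >>.
  have := eG 0 0; rewrite (@br_basis_GG_even _ _ 0) // addrC => /eZV - /(_ (sgn0 _)).
  move/eB => /(_ (eZ _ _ eL0)) /eZV; apply.
  rewrite /degG mul0r expr0n sub0r mulr1 mulrN oppr_eq0 mulf_neq0 //;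
    by rewrite invr_eq0 pnatr_eq0.
apply: linear_ext => // -[n|k|k|] //; rewrite -/(e _).
- have := eG n n; rewrite (@br_basis_GG_even _ _ n) => [/eZV|]; last lia.
  by move=> /(_ (sgn0 _)) /eB /(_ (eZ _ _ ec)) /eZV; apply.
- have := eG 0 (2 * k + 1); rewrite (@br_basis_GG_odd _ _ k) => [/eZV|]; last lia.
  apply; rewrite mulf_neq0 // /degG mul0r sub0r oppr_eq0 mulf_neq0 ?invr_eq0 //.
  by rewrite intr_eq0; lia.
Qed.

(** The scalar by which an even basis vector moves one odd basis vector to
another. *)
Definition ad_coef (a : tw_index) (l : int) : F :=
  match a with
  | iL n => n%:~R / 2 - degG l
  | iT _ => 1
  | _ => 0
  end.

Lemma br_basis_G a l : ~~ tw_odd a ->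
  br_basis a (iG l) = ad_coef a l *: << iG (tw_deg a + l) >> :> V.
Proof.
case: a => [n|k|k|] a_even; rewrite /br_basis /tw_deg /ad_coef.
- by rewrite [2 * n + l]addrC.
- by rewrite scale1r (_ : 2 * k + 1 + l = l + 2 * k + 1) //; lia.
- by [].
- by rewrite scale0r.
Qed.

Lemma part_basis b : parity_part (tw_odd b) (<< b >> : V).
Proof. by move=> b'; rewrite msuppU oner_eq0 inE => /eqP ->. Qed.

Lemma part_L0 : parity_part false (<< iL 0 >> : V).
Proof. exact: (@part_basis (iL 0)). Qed.

Lemma part_G k : parity_part true (<< iG k >> : V).
Proof. exact: (@part_basis (iG k)). Qed.

Lemma part_odd_supp x b : parity_part true x -> b \in msupp x -> b = iG (tw_deg b).
Proof. by move=> px /px; case: b. Qed.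

(** There is one odd basis vector in each degree, and one even basis vector in
each nonzero degree.  So only the product of the two leading terms reaches the
top degree of the bracket. *)
Lemma br_leading x y b0 q : parity_part false x -> parity_part true y ->
    b0 \in msupp x -> 0 < tw_deg b0 ->
    (forall b, b \in msupp x -> tw_deg b <= tw_deg b0) ->
    iG q \in msupp y -> (forall b, b \in msupp y -> tw_deg b <= q) ->
  (br x y)@_(iG (tw_deg b0 + q)) = x@_b0 * y@_(iG q) * ad_coef b0 q.
Proof.
move=> px py b0x b0_gt0 xmax qy ymax.
(* Equality of total degrees forces both degrees to be maximal. *)
have only a b : a \in msupp x -> b \in msupp y ->
    (br_basis a b : V)@_(iG (tw_deg b0 + q)) != 0 -> a = b0 /\ b = iG q.
  move=> ax /[dup] /(part_odd_supp py) -> by_ /br_basis_homogeneous /= e.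
  have := xmax _ ax; have := ymax _ by_; rewrite /= => ? ?.
  have ab : tw_deg a = tw_deg b0 by lia.
  split; last by congr iG; lia.
  move: (px _ ax) (px _ b0x) ab b0_gt0.
  case: (a) (b0) => [?|?|?|] [?|?|?|] //= _ _ *;
    by first [congr iL; lia | congr iT; lia | lia].
have zero a b : a \in msupp x -> b \in msupp y -> (a != b0) || (b != iG q) ->
    (br_basis a b : V)@_(iG (tw_deg b0 + q)) = 0.
  move=> ax yb; apply: contraTeq => /(only _ _ ax yb) [-> ->].
  by rewrite !eqxx.
rewrite /br raddf_sum (big_fsetD1 b0) //= [X in _ + X]big1_seq ?addr0; last first.
  move=> a /=; rewrite !inE => /andP[ab ax]; rewrite raddf_sum big1_seq // => b /= yb.
  by rewrite mcoeffZ zero ?ab ?mulr0.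
rewrite raddf_sum (big_fsetD1 (iG q)) //= [X in _ + X]big1_seq ?addr0; last first.
  move=> b /=; rewrite !inE => /andP[bq yb].
  by rewrite mcoeffZ zero ?bq ?orbT ?mulr0.
rewrite mcoeffZ br_basis_G ?mcoeffZ ?mcoeffU ?eqxx ?mulr1 //.
by rewrite (px _ b0x).
Qed.

Lemma br_basis_L0 b : br_basis (iL 0) b = - degG (tw_deg b) *: << b >> :> V.
Proof.
case: b => [n|k|k|]; rewrite /br_basis /tw_deg.
- rewrite (_ : (0 ^+ 3 - 0)%:~R / 12 * _ = 0) ?scale0r ?addr0; last first.
    by rewrite expr0n /= 2!mul0r.
  rewrite !add0r (_ : (- n)%:~R = - degG (2 * n)) // /degG.
  by field; rewrite ?pnatr_eq0.
- rewrite addr0 (_ : degT k = degG (2 * k + 1)) // /degG /degT.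
  by field; rewrite ?pnatr_eq0.
- by rewrite mulr0 addr0 mul0r sub0r.
- by rewrite /degG mul0r oppr0 scale0r.
Qed.

Lemma br_L0 x b : (br << iL 0 >> x)@_b = - degG (tw_deg b) * x@_b.
Proof.
have -> : br << iL 0 >> x = monomial_map (fun b => - degG (tw_deg b)) id x.
  apply: linear_ext x => [|c x y|b']; first exact: br_linearr.
    exact: linear_extend_linear.
  by rewrite brUU br_basis_L0 /monomial_map linear_extendU.
by rewrite [LHS]monomial_mapE.
Qed.

End Classification.

(** * Automorphisms permute the odd lines *)

Section NormalForm.
Context {F : numClosedFieldType}.
Local Notation V := {malg F[tw_index]}.
Implicit Types (x y : V) (s t : V -> V).

Lemma seq_argmax (T : eqType) (f : T -> int) (l : seq T) a : a \in l ->
  exists2 m, m \in l & forall b, b \in l -> f b <= f m.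
Proof.
elim: l a => // a0 l IH a _.
case: l IH => [|a1 l] IH.
  by exists a0; rewrite ?mem_head // => b; rewrite inE => /eqP ->.
have [m ml mmax] := IH _ (mem_head a1 l).
have [le|lt] := leP (f a0) (f m).
  exists m; first by rewrite in_cons ml orbT.
  by move=> b; rewrite in_cons => /predU1P[-> //|/mmax].
exists a0; first exact: mem_head.
move=> b; rewrite in_cons => /predU1P[-> //|/mmax] bm.
exact: le_trans bm (ltW lt).
Qed.

Lemma supp_neq0 x : x != 0 -> exists b, b \in msupp x.
Proof.
move=> x0; apply: contrapT => none; case/eqP: x0; apply/malgP => b.
rewrite mcoeff0 mcoeff_outdom //; apply/negP => bx.
by apply: none; exists b.
Qed.

Lemma automorphism_comp s t :
  is_automorphism s -> is_automorphism t -> is_automorphism (s \o t).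
Proof.
move=> [sl sb sp sm] [tl tb tp tm]; split.
- by move=> a x y /=; rewrite tl sl.
- exact: bij_comp.
- by move=> e; rewrite -classical_sets.image_comp tp sp.
- by move=> x y /=; rewrite tm sm.
Qed.

Lemma automorphism_part s e x :
  is_automorphism s -> parity_part e x -> parity_part e (s x).
Proof. by case=> _ _ sp _ px; rewrite -(sp e); exists x. Qed.

Lemma automorphism_neq0 s b : is_automorphism s -> s << b >> != 0.
Proof.
case=> sl /bij_inj sI _ _; apply/eqP => s0.
have s00 : s 0 = 0 by rewrite -(scale0r (0 : V)) linear_scale // !scale0r.
have : s << b >> = s 0 by rewrite s0 s00.
by move/sI/eqP; rewrite monalgU_eq0 oner_eq0.
Qed.

Lemma automorphism_L0_eigen s k : is_automorphism s ->
  br (s << iL 0 >>) (s << iG k >>) = - degG k *: s << iG k >>.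
Proof. by case=> sl _ _ sm; rewrite -sm brUU br_basis_L0 linear_scale. Qed.

(** Surjectivity on the odd part, coordinate by coordinate. *)
Lemma automorphism_hits_G s m : is_automorphism s ->
  exists k, iG m \in msupp (s << iG k >>).
Proof.
case=> sl _ sp _.
have : parity_part true (<< iG m >> : V) by exact: part_G.
rewrite -(sp true) => -[y py sy].
have : (s y)@_(iG m) != 0 by rewrite sy mcoeffU eqxx oner_eq0.
rewrite (linear_extendE sl) /linear_extend raddf_sum /= => nz.
apply: contrapT => none; case/negP: nz; apply/eqP.
apply: big1_seq => b /= /(part_odd_supp py) ->.
rewrite mcoeffZ [X in _ * X]mcoeff_outdom ?mulr0 //; apply/negP => bm.
by apply: none; exists (tw_deg b).
Qed.

(** The leading term [b0] of [s L_0], of positive degree, would shift the top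
degree [q] of the eigenvector [s G_(k/2)] to a degree where the eigenvector
vanishes.  Hence [ad_coef b0 q = 0], which is impossible for [b0 = T_r] and means
[q = n] for [b0 = L_n].  Then no [s G_(k/2)] has a component of degree above that
of [b0]. *)
Lemma automorphism_L0_top s b : is_automorphism s ->
  b \in msupp (s << iL 0 >>) -> tw_deg b <= 0.
Proof.
move=> sA bx; rewrite leNgt; apply/negP => b_gt0.
have [b0 b0x b0max] := seq_argmax tw_deg bx.
have b0_gt0 := lt_le_trans b_gt0 (b0max _ bx).
have peven : parity_part false (s << iL 0 >>).
  by apply: automorphism_part => //; exact: part_L0.
have podd k : parity_part true (s << iG k >>).
  by apply: automorphism_part => //; exact: part_G.
(* Enough, because the odd basis vector just above the bound is attained. *)
suff bound k a : a \in msupp (s << iG k >>) -> tw_deg a <= tw_deg b0.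
  have [k /bound] := automorphism_hits_G (tw_deg b0 + 1) sA.
  by rewrite /=; lia.
move=> ay; have [c cy cmax] := seq_argmax tw_deg ay.
apply: le_trans (cmax _ ay) _.
have cE := part_odd_supp (podd k) cy; rewrite cE in cy.
have := br_leading peven (podd k) b0x b0_gt0 b0max cy cmax.
rewrite automorphism_L0_eigen // mcoeffZ [X in _ * X]mcoeff_outdom; last first.
  by apply/negP => /cmax /=; lia.
rewrite mulr0 => /esym/eqP; rewrite !mulf_eq0 !mcoeff_eq0 b0x cy /=.
move: b0_gt0 (peven _ b0x); case: (b0) => [n|l|l|] //= n_gt0 _; last first.
  by rewrite oner_eq0.
rewrite /degG -mulrBl mulf_eq0 invr_eq0 pnatr_eq0 orbF subr_eq0 eqr_int.
by move/eqP; lia.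
Qed.

(** Applying the degree bound to [s] and to its composite with the reflection
leaves only degree 0. *)
Lemma automorphism_L0 s : is_automorphism s ->
  exists a c : F, s << iL 0 >> = a *: << iL 0 >> + c *: << ic >>.
Proof.
move=> sA; set x := s _.
have peven : parity_part false x.
  by apply: automorphism_part => //; exact: part_L0.
have deg0 b : b \in msupp x -> b = iL 0 \/ b = ic.
  move=> bx; have le0 := automorphism_L0_top sA bx.
  have ge0 : 0 <= tw_deg b.
    have rA := automorphism_comp reflection_automorphism sA.
    have coef := monomial_mapE reflect_coef x b (inv_inj reflect_indexK).
    have : reflect_index b \in msupp ((reflection \o s) << iL 0 >> : V).
      rewrite -mcoeff_neq0 /= /reflection -/x coef mulf_neq0 ?mcoeff_neq0 //.
      by case: (b) => *; rewrite /= ?oppr_eq0 ?oner_eq0 ?neq0Ci.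
    move/(automorphism_L0_top rA); move: (peven _ bx).
    by case: (b) => [n|k|k|] //=; lia.
  move: (peven _ bx) le0 ge0; case: (b) => [n|k|k|] //= _ *; last by right.
    by left; congr iL; lia.
  by exfalso; lia.
exists x@_(iL 0), x@_ic; apply/malgP => b.
rewrite mcoeffD 2!mcoeffZ 2!mcoeffU.
have [bx|bx] := boolP (b \in msupp x).
  by case: (deg0 b bx) => ->; rewrite !mulr0 mulr1 ?addr0 ?add0r.
rewrite mcoeff_outdom //.
case: (iL 0 =P b) bx => [<-|_] bx; first by rewrite mcoeff_outdom ?mul0r ?mulr0 ?addr0.
case: (ic =P b) bx => [<-|_] bx; last by rewrite !mulr0 addr0.
by rewrite mulr0 add0r [x@_ic]mcoeff_outdom ?mul0r.
Qed.

Definition acts_on_G (q : int) (g : int -> F) s : Prop :=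
  forall k, s << iG k >> = g k *: << iG (q * k) >>.

(** On the odd part, [s L_0 = a L_0 + c'] acts by [- a * degree / 2], so the
eigenvalue [- k / 2] occurs in the single degree [k / a].  This makes [1 / a] an
integer [q]; it is invertible because [G_(1/2)] is attained. *)
Lemma automorphism_on_G s : is_automorphism s ->
  exists q g, [/\ q = 1 \/ q = -1, forall k, g k != 0 & acts_on_G q g s].
Proof.
move=> sA; have [a [c sL0]] := automorphism_L0 sA.
have podd k : parity_part true (s << iG k >>).
  by apply: automorphism_part => //; exact: part_G.
have eigen k m : iG m \in msupp (s << iG k >>) -> a * m%:~R = k%:~R.
  move=> my; have := automorphism_L0_eigen k sA.
  have brc y : br << ic >> y = 0.
    by rewrite brE linear_extendU /linear_extend big1 // => b _; rewrite scaler0.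
  rewrite sL0 (linear_add _ _ (br_linearl _)) !brZl brc scaler0 addr0.
  move/(congr1 (mcoeff (iG m))); rewrite 2!mcoeffZ br_L0 /= mulrA.
  move/(mulIf _); rewrite mcoeff_neq0 => /(_ my)/eqP.
  rewrite mulrN eqr_opp /degG mulrA => /eqP /mulIf; apply.
  by rewrite invr_eq0 pnatr_eq0.
have [b by_] := supp_neq0 (automorphism_neq0 (iG 1) sA).
have /eigen a1 : iG (tw_deg b) \in msupp (s << iG 1 >>).
  by rewrite -(part_odd_supp (podd 1) by_).
move: (tw_deg b) a1 => q aq.
have a0 : a != 0.
  by apply: contra_eq_neq aq => ->; rewrite mul0r eq_sym oner_eq0.
have supp k b' : b' \in msupp (s << iG k >>) -> b' = iG (q * k).
  move=> b'y; have b'E := part_odd_supp (podd k) b'y.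
  rewrite b'E; congr iG; rewrite b'E in b'y.
  apply/eqP; rewrite -(eqr_int F); apply/eqP/(mulfI a0).
  by rewrite (eigen _ _ b'y) intrM mulrA aq mul1r.
have act : acts_on_G q (fun k => (s << iG k >>)@_(iG (q * k))) s.
  move=> k; apply/malgP => b'; rewrite mcoeffZ mcoeffU.
  case: (iG (q * k) =P b') => [<-|ne]; first by rewrite mulr1.
  by rewrite mulr0 mcoeff_outdom //; apply/negP => /supp e; apply: ne.
exists q, (fun k => (s << iG k >>)@_(iG (q * k))); split=> // [|k].
  have [k /supp [e]] := automorphism_hits_G 1 sA.
  have : (`|q| * `|k|)%N == 1%N by rewrite -abszM -e.
  by rewrite muln_eq1 => /andP[/eqP ? _]; lia.
apply: contra_neq (automorphism_neq0 (iG k) sA) => g0.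
by rewrite act g0 scale0r.
Qed.

(** Transporting [[T_(1/2), G_(k/2)] = G_((k + 1)/2)], where [T_(1/2)] is itself
a bracket of [G_0] and [G_(1/2)], makes the eigenvalues a geometric sequence.  Its
first step [g 1 = g 0 * g 1 * g 0] gives the sign. *)
Lemma automorphism_scale s g : is_automorphism s -> (forall k, g k != 0) ->
  acts_on_G 1 g s ->
  g 0 ^+ 2 = 1 /\ forall k, g k = g 0 * (g 0 * g 1) ^ k.
Proof.
move=> [sl _ _ sm] g0 act.
have actE k : s << iG k >> = g k *: << iG k >> by rewrite act mul1r.
have sT : s << iT 0 >> = (g 0 * g 1) *: << iT 0 >>.
  have two0 : 2^-1 != 0 :> F by rewrite invr_eq0 pnatr_eq0.
  apply: (scalerI two0); rewrite -linear_scale // -br_basis_G0G1 -brUU sm.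
  by rewrite !actE brZl brZr brUU br_basis_G0G1 !scalerA; congr (_ *: _); ring.
have step k : g (k + 1) = g 0 * g 1 * g k.
  have := sm << iT 0 >> << iG k >>.
  rewrite sT actE brZl brZr brUU /br_basis mulr0 addr0 actE.
  by move/(congr1 (mcoeff (iG (k + 1)))); rewrite 3!mcoeffZ mcoeffU eqxx !mulr1.
have g02 : g 0 ^+ 2 = 1.
  have := step 0; rewrite add0r => e; apply: (mulIf (g0 1)).
  by rewrite mul1r [RHS]e; ring.
split=> //.
have t0 : g 0 * g 1 != 0 by rewrite mulf_neq0.
elim=> [|n IH|n IH]; first by rewrite expr0z mulr1.
- by rewrite (_ : n.+1%:Z = n%:Z + 1) ?step ?IH ?exprSzr ?expfzDr ?expr1z //; [ring|lia].
- apply: (mulfI t0); rewrite -step (_ : - n.+1%:Z + 1 = - n%:Z); last lia.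
  rewrite IH mulrCA; congr (_ * _).
  rewrite -{2}[g 0 * g 1]expr1z -expfzDr //; congr (_ ^ _); lia.
Qed.

End NormalForm.

(** * Composing actions on the odd lines *)

Section ActionOnG.
Context {F : numClosedFieldType}.
Local Notation V := {malg F[tw_index]}.
Implicit Types (s t : V -> V) (g h : int -> F).

Lemma acts_on_G_eq q q' g g' s : q = q' -> g =1 g' ->
  acts_on_G q g s -> acts_on_G q' g' s.
Proof. by move=> <- gg' sg k; rewrite sg gg'. Qed.

Lemma acts_on_G_comp q q' g g' s t : linear s ->
  acts_on_G q g s -> acts_on_G q' g' t ->
  acts_on_G (q * q') (fun k => g' k * g (q' * k)) (s \o t).
Proof. by move=> sl sg tg k; rewrite /= tg linear_scale // sg scalerA mulrA. Qed.

Lemma acts_on_G_inv q g s t : linear t -> cancel s t -> q * q = 1 ->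
  (forall k, g k != 0) -> acts_on_G q g s ->
  acts_on_G q (fun k => (g (q * k))^-1) t.
Proof.
move=> tl st qq g0 sg k; rewrite -[in RHS](st << iG (q * k) >>) sg.
by rewrite mulrA qq mul1r linear_scale // scalerA mulVf ?scale1r.
Qed.

Lemma acts_on_G_at0 q q' g g' s :
  acts_on_G q g s -> acts_on_G q' g' s -> g 0 = g' 0.
Proof.
move=> sg sg'; have := sg' 0; rewrite sg !mulr0.
move/(congr1 (mcoeff (iG 0))).
by rewrite 2!mcoeffZ mcoeffU eqxx !mulr1.
Qed.

Lemma reflection_on_G : acts_on_G (-1) (fun=> 'i) (reflection : V -> V).
Proof. by move=> k; rewrite /reflection /monomial_map linear_extendU mulN1r. Qed.

Lemma grading_on_G (z : F) : acts_on_G 1 (fun k => z ^ k)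
  (monomial_map (fun b => z ^ tw_deg b) id : V -> V).
Proof. by move=> k; rewrite /monomial_map linear_extendU mul1r. Qed.

(** Here [e p] stands for [exp (- l p)], the factor that [exp (l ad L_0)] attaches
to the eigenvalue [- p]. *)
Lemma exp_adL0_on_G (e : F -> F) s :
    (forall p x, br << iL 0 >> x = - p *: x -> s x = e p *: x) ->
  acts_on_G 1 (fun k => e (degG k)) s.
Proof. by move=> se k; rewrite mul1r; apply: se; rewrite brUU br_basis_L0. Qed.

(** A vector with [ad L_0]-eigenvalue [- p] only has components in degree [2p],
where the grading automorphism is the scalar prescribed by [e]. *)
Lemma grading_exp_adL0 (e : F -> F) (z : F) s :
    is_automorphism s -> z != 0 -> acts_on_G 1 (fun k => z ^ k) s ->
    (forall k, e (degG k) = z ^ k) ->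
  forall p x, br << iL 0 >> x = - p *: x -> s x = e p *: x.
Proof.
move=> sA z0 sz ez p x xp.
rewrite (automorphism_ext sA (grading_automorphism z0)) => [|k]; last first.
  by rewrite sz -(grading_on_G z k).
apply/malgP => b; rewrite [LHS]monomial_mapE // mcoeffZ.
have [->|xb] := eqVneq x@_b 0; first by rewrite !mulr0.
have := congr1 (mcoeff b) xp; rewrite br_L0 mcoeffZ => /(mulIf xb)/oppr_inj <-.
by rewrite ez.
Qed.

Lemma exprCi_eq1 n : (n < 4)%N -> 'i ^+ n = 1 :> F -> n = 0%N.
Proof.
have N1 : -1 != 1 :> F.
  by rewrite eq_sym -subr_eq0 opprK -(natrD _ 1 1) pnatr_eq0.
case: n => [|[|[|[|n]]]] // _ e; case/eqP: N1.
- by rewrite -sqrCi -['i]expr1 e expr1n.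
- by rewrite -sqrCi.
- have : ('i ^+ 2) ^+ 3 = 1 :> F by rewrite exprAC e expr1n.
  by rewrite sqrCi => e3; rewrite -[RHS]e3; ring.
Qed.

Lemma oppr_mul2_degG (z : F) k : - (- (2 * z) * degG k) = z * k%:~R.
Proof. by rewrite /degG; field; rewrite ?pnatr_eq0. Qed.

Lemma oppr_mul_degG (z : F) k : - (z * degG k) = - (z / 2) * k%:~R.
Proof. by rewrite /degG; field; rewrite ?pnatr_eq0. Qed.

End ActionOnG.

(** * The complex exponential *)

Section ComplexExponential.
Context {R : realType}.
Local Open Scope complex_scope.
Implicit Types z w : R[i].

Lemma expCD z w : expC (z + w) = expC z * expC w.
Proof.
case: z w => [a b] [c d]; rewrite /expC /= expRD cosD sinD.
by apply/eqP; rewrite eq_complex /=; apply/andP; split; apply/eqP; ring.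
Qed.

Lemma expC0 : expC (0 : R[i]) = 1.
Proof. by rewrite /expC /= expR0 cos0 sin0 mulr1 mulr0. Qed.

Lemma expC_neq0 z : expC z != 0.
Proof.
apply/eqP => z0; have := expCD z (- z).
by rewrite subrr expC0 z0 mul0r => /eqP; rewrite oner_eq0.
Qed.

Lemma expC_int z (k : int) : expC (z * k%:~R) = expC z ^ k.
Proof.
elim: k => [|n IH|n IH]; first by rewrite mulr0 expC0 expr0z.
- rewrite (_ : n.+1%:Z = n%:Z + 1); last lia.
  by rewrite intrD mulrDr mulr1 expCD IH expfzDr ?expC_neq0 // expr1z.
- apply: (mulIf (expC_neq0 z)); rewrite -expCD -{2}[expC z]expr1z.
  rewrite -expfzDr ?expC_neq0 // (_ : - n.+1%:Z + 1 = - n%:Z); last lia.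
  rewrite -IH -{2}[z]mulr1 -mulrDr; congr (expC (_ * _)).
  by rewrite -[X in _ + X]/(1%:~R) -intrD; congr (_ %:~R); lia.
Qed.

(** Polar form: the argument is [acos] of the normalized real part, up to the
sign of the imaginary part. *)
Lemma expC_onto z : z != 0 -> exists w, expC w = z.
Proof.
case: z => [a b] z0; set r := Num.sqrt (a ^+ 2 + b ^+ 2).
have r2 : r ^+ 2 = a ^+ 2 + b ^+ 2.
  by rewrite sqr_sqrtr // addr_ge0 ?sqr_ge0.
have r0 : 0 < r.
  rewrite sqrtr_gt0 lt_def addr_ge0 ?sqr_ge0 // andbT.
  by rewrite paddr_eq0 ?sqr_ge0 // !sqrf_eq0; move: z0; rewrite eq_complex.
have ab1 : (a / r) ^+ 2 + (b / r) ^+ 2 = 1.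
  by rewrite !expr_div_n -mulrDl -r2 mulfV // expf_neq0 // gt_eqF.
have a1 : -1 <= a / r <= 1.
  rewrite -ler_norml -(@ler_pXn2r _ 2) ?nnegrE // expr1n -normrX ger0_norm ?sqr_ge0 //.
  by rewrite -ab1 lerDl sqr_ge0.
pose sg : R := if 0 <= b then 1 else -1.
have sinE : sin (sg * acos (a / r)) = b / r.
  have s1 : sin (acos (a / r)) = `|b / r|.
    rewrite sin_acos // -sqrtr_sqr; congr (Num.sqrt _).
    by rewrite -ab1 addrAC subrr add0r.
  rewrite /sg; case: ifPn => [b0|].
    by rewrite mul1r s1 ger0_norm // divr_ge0 // ltW.
  rewrite -ltNge => b0; rewrite mulN1r sinN s1 ltr0_norm ?opprK //.
  by rewrite pmulr_llt0 ?invr_gt0.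
have cosE : cos (sg * acos (a / r)) = a / r.
  have -> : cos (sg * acos (a / r)) = cos (acos (a / r)).
    by rewrite /sg; case: ifP => _; rewrite ?mul1r // mulN1r cosN.
  by rewrite acosK // in_itv.
exists (ln r +i* (sg * acos (a / r))).
rewrite /expC cosE sinE lnK ?posrE //.
by rewrite ![r * (_ / r)]mulrC !mulfVK // gt_eqF.
Qed.

Lemma expC_2pi : expC (0 +i* (pi *+ 2) : R[i]) = 1.
Proof. by rewrite /expC expR0 cos2pi sin2pi mulr0 mulr1. Qed.

(** A generator of the inner automorphism group has a nonzero parameter; when the
logarithm found is 0, the period replaces it. *)
Lemma expC_onto_neq0 z : z != 0 -> exists2 w, w != 0 & expC w = z.
Proof.
move=> /expC_onto [w wz]; have [w0|w0] := eqVneq w 0; last by exists w.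
exists (0 +i* (pi *+ 2)); last by rewrite expC_2pi -wz w0 expC0.
by rewrite eq_complex /= eqxx /= mulrn_eq0 /= gt_eqF // pi_gt0.
Qed.

End ComplexExponential.

(** * The structure of the automorphism group *)

Lemma subgroup_intro (G : groupType) (H : set G) :
  H 1%g -> (forall x y, H x -> H y -> H (x / y)%g) -> subgroup H.
Proof.
move=> H1 HB; split; first exact: mem_set.
by move=> x y /set_mem Hx /set_mem Hy; apply/mem_set/HB.
Qed.

Section AutGroup.
Context {R : realType}.
Local Notation V := {malg R[i][tw_index]}.
Implicit Types (s t : aut R) (q : int).

Lemma aut_automorphism s : is_automorphism (s : V -> V).
Proof. by rewrite -is_autE; exact: autP. Qed.

Lemma automorphism_is_aut (f : V -> V) : is_automorphism f -> @is_aut R f.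
Proof. by rewrite is_autE. Qed.

(** Keeping the scalar action on the odd lines behind this predicate lets the
composition laws of the previous sections serve as a calculus in the group. *)
Definition acts s q (g : int -> R[i]) := acts_on_G q g (s : V -> V).

Lemma acts_eq q q' g g' s : q = q' -> g =1 g' -> acts s q g -> acts s q' g'.
Proof. exact: acts_on_G_eq. Qed.

Lemma aut_linear s : linear (s : V -> V).
Proof. by have [] := aut_automorphism s. Qed.

Lemma acts_mul s t q q' g g' : acts s q g -> acts t q' g' ->
  acts (s * t)%g (q * q') (fun k => g' k * g (q' * k)).
Proof. by move=> sg tg; apply: acts_on_G_comp (aut_linear s) sg tg. Qed.

Lemma acts_inv s q g : q * q = 1 -> (forall k, g k != 0) -> acts s q g ->
  acts (s^-1)%g q (fun k => (g (q * k))^-1).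
Proof.
move=> qq g0 sg; apply: acts_on_G_inv (aut_linear _) _ qq g0 sg => x.
by rewrite -[LHS]/((s^-1 * s)%g x) mulVg.
Qed.

Lemma acts1 : acts 1%g 1 (fun=> 1).
Proof. by move=> k; rewrite scale1r mul1r. Qed.

Lemma acts_inj s t q g : acts s q g -> acts t q g -> s = t.
Proof.
move=> sg tg; apply: aut_inj.
apply: (automorphism_ext (aut_automorphism s) (aut_automorphism t)) => k.
by rewrite sg tg.
Qed.

Lemma acts_ex s :
  exists q g, [/\ q = 1 \/ q = -1, forall k, g k != 0 & acts s q g].
Proof. exact: automorphism_on_G (aut_automorphism s). Qed.

Lemma is_exp_adL0_acts l s :
  is_exp_adL0 l s -> acts s 1 (fun k => expC (- (l / 2)) ^ k).
Proof.
move=> sl; apply: acts_on_G_eq (exp_adL0_on_G (e := fun p => expC (- (l * p))) _) => //.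
by move=> k; rewrite oppr_mul_degG expC_int.
Qed.

Lemma acts_is_exp_adL0 (z : R[i]) s : z != 0 -> acts s 1 (fun k => z ^ k) ->
  exists2 l : R[i], l != 0 & is_exp_adL0 l s.
Proof.
move=> z0 sz; have [w w0 wz] := expC_onto_neq0 z0.
(* [G_(k/2)] has weight k/2, so that exp (- l k / 2) = exp (w k). *)
exists (- (2 * w)); first by rewrite oppr_eq0 mulf_neq0 // pnatr_eq0.
have ez (k : int) : expC (- (- (2 * w) * degG k)) = z ^ k.
  by rewrite oppr_mul2_degG expC_int wz.
exact: (grading_exp_adL0 (e := fun p => expC (- (- (2 * w) * p)))
  (aut_automorphism s) z0 sz ez).
Qed.

(** By [automorphism_ext] these are the automorphisms [z ^ degree]. *)
Definition scalings : set (aut R) :=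
  [set s | exists2 z : R[i], z != 0 & acts s 1 (fun k => z ^ k)].

Lemma subgroup_scalings : subgroup scalings.
Proof.
apply: subgroup_intro => [|t u].
  by exists 1; [exact: oner_neq0 | apply: acts_eq acts1 => // k; rewrite exp1rz].
move=> [z z0 tz] [w w0 uw]; exists (z / w); first by rewrite mulf_neq0 ?invr_neq0.
have w0k k : w ^ k != 0 by exact: expfz_neq0.
apply: acts_eq (acts_mul tz (acts_inv (mulr1 1) w0k uw)) => // k.
by rewrite !mul1r mulrC expfzMl exprz_inv invr_expz.
Qed.

Lemma InnE : Inn R = scalings.
Proof.
apply/seteqP; split.
  apply: smallest_sub; first exact: subgroup_scalings.
  move=> t [l l0 /is_exp_adL0_acts tl].
  by exists (expC (- (l / 2))); first exact: expC_neq0.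
move=> s [z z0 /(acts_is_exp_adL0 z0) sl].
exact: sub_gen_smallest.
Qed.

(** Conjugation by an automorphism of orientation [q] turns the scalar [z] into
[z ^ q]: the coefficients of [g] cancel. *)
Lemma normal_scalings n g : scalings n -> scalings (n ^ g)%g.
Proof.
move=> [z z0 nz]; have [q [c [q1 c0 gc]]] := acts_ex g.
have qq : q * q = 1 by case: q1 => ->.
exists (z ^ q); first exact: expfz_neq0.
apply: acts_eq (acts_mul (acts_inv qq c0 gc) (acts_mul nz gc)) => [|k].
  by rewrite mul1r.
by rewrite mul1r mulrA qq mul1r mulrAC mulfV // mul1r exprz_exp.
Qed.

Definition rho : aut R := Aut (automorphism_is_aut reflection_automorphism).

Lemma acts_rho : acts rho (-1) (fun=> 'i%R).
Proof. exact: reflection_on_G. Qed.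

Lemma acts_rhoX n : acts (rho ^+ n)%g ((-1) ^+ n) (fun=> 'i%R ^+ n).
Proof.
elim: n => [|n IH]; first exact: acts1.
rewrite expgS; apply: acts_eq (acts_mul acts_rho IH) => [|k].
  by rewrite exprS.
by rewrite exprSr.
Qed.

Lemma rho4 : (rho ^+ 4 = 1)%g.
Proof.
apply: acts_inj acts1; apply: acts_eq (acts_rhoX 4) => // k.
by rewrite (exprM _ 2 2) sqrCi sqrrN expr1n.
Qed.

Lemma rhoX_eq1 n : (n < 4)%N -> (rho ^+ n = 1)%g -> n = 0%N.
Proof.
move=> n4 e; apply: (@exprCi_eq1 R[i]) => //.
have rn : acts 1%g ((-1) ^+ n) (fun=> 'i%R ^+ n) by rewrite -e; exact: acts_rhoX.
exact: acts_on_G_at0 rn acts1.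
Qed.

Definition rho_power (i : 'Z_4) : aut R := (rho ^+ i)%g.

Lemma rho_powerD : {morph rho_power : i j / (i + j)%R >-> (i * j)%g}.
Proof.
move=> i j; rewrite /rho_power -expgnDr [in RHS](divn_eq (i + j) 4).
by rewrite expgnDr mulnC expgnA rho4 expg1n mul1g.
Qed.

Lemma rho_power_inj : injective rho_power.
Proof.
move=> i j ij; apply/eqP; rewrite -subr_eq0; apply/eqP.
suff ij0 : nat_of_ord (i - j) = 0%N by apply: val_inj.
apply: rhoX_eq1; first exact: (ltn_ord (i - j)).
apply: (mulIg (rho_power j)); rewrite mul1g -[RHS]ij.
by rewrite -[X in (X * _)%g]/(rho_power (i - j)) -rho_powerD subrK.
Qed.

Lemma rho_power0 : rho_power 0 = 1%g.
Proof. by []. Qed.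

Lemma rho_powerV i : rho_power (- i) = (rho_power i)^-1%g.
Proof.
apply: (mulIg (rho_power i)).
by rewrite mulVg -rho_powerD addNr rho_power0.
Qed.

(** [rho] repairs the orientation and [rho ^ 2], which is -1 on the odd part,
repairs the sign of [c 0]. *)
Lemma scalings_rho_power g :
  exists2 n, scalings n & exists i, g = (n * rho_power i)%g.
Proof.
have split_orientation s c : (forall k, c k != 0) -> acts s 1 c ->
    exists2 n, scalings n & exists i, s = (n * rho_power i)%g.
  move=> c0 sc; have [c2 cE] := automorphism_scale (aut_automorphism s) c0 sc.
  have z0 : c 0 * c 1 != 0 by rewrite mulf_neq0.
  move/eqP: c2; rewrite sqrf_eq1 => /orP[]/eqP c01.
    exists s; last by exists 0; rewrite rho_power0 mulg1.
    exists (c 0 * c 1); first exact: z0.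
    by apply: acts_eq erefl _ sc => k; rewrite [LHS]cE [X in X * _]c01 [LHS]mul1r.
  have r2 : acts (rho_power 2) 1 (fun=> -1).
    by apply: acts_eq (acts_rhoX 2) => [|k]; rewrite ?sqrrN ?expr1n ?sqrCi.
  exists (s * rho_power 2)%g; last first.
    exists 2; rewrite -mulgA -rho_powerD (_ : 2 + 2 = 0).
      by rewrite rho_power0 mulg1.
    exact: val_inj.
  exists (c 0 * c 1); first exact: z0.
  apply: acts_eq (mulr1 1) _ (acts_mul sc r2) => k.
  by rewrite mulN1r mul1r [in LHS]cE [X in - (X * _)]c01 mulN1r opprK.
have [q [c [[] -> c0 gc]]] := acts_ex g; first exact: split_orientation gc.
have r1 : acts (rho_power 1) (-1) (fun=> 'i%R) by exact: acts_rho.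
have [|n nS [i gi]] := split_orientation _ _ _ (acts_mul gc r1).
  by move=> k; rewrite mulf_neq0 ?neq0Ci.
exists n => //; exists (i - 1).
by rewrite rho_powerD rho_powerV mulgA -gi mulgK.
Qed.

(** [G_0] is fixed by scalings, while [rho ^ i] multiplies it by the [i]-th power of
the imaginary unit. *)
Lemma scalings_rho_power_trivial i : scalings (rho_power i) -> i = 0.
Proof.
move=> [z z0 sz].
suff i0 : nat_of_ord i = 0%N by apply: val_inj.
apply: (@exprCi_eq1 R[i]); first exact: (ltn_ord i).
by rewrite (acts_on_G_at0 (acts_rhoX i) sz) expr0z.
Qed.

End AutGroup.

Theorem theorem1p5 (R : realType) :
  exists H : set (aut R), isomorphic_Z4 H /\ internal_semidirect (Inn R) H.
Proof.
exists (range (@rho_power R)); split.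
  exists (@rho_power R); split=> //; [exact: rho_powerD | exact: rho_power_inj].
rewrite InnE; split.
- by split; [exact: subgroup_scalings | exact: normal_scalings].
- apply: subgroup_intro => [|_ _ [i _ <-] [j _ <-]]; first by exists 0.
  by exists (i - j) => //; rewrite rho_powerD rho_powerV.
- apply/seteqP; split=> [_ [/[swap] [[i _ <-]]] /scalings_rho_power_trivial -> //|].
  move=> _ ->; split; last by exists 0.
  by exists 1; [exact: oner_neq0 | apply: acts_eq (@acts1 R) => // k; rewrite exp1rz].
- move=> g; have [n nS [i gi]] := scalings_rho_power g.
  by exists n => //; exists (rho_power i) => //; exists i.
Qed.
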